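(* If $T$ is a tree of order $n$ and maximum degree $\Delta$, then $$\mathrm{aecc}_3(T)\le \mathrm{aecc}_3(B(n,\Delta))=n-\Delta+1+\frac{\Delta}{n}.$$
   Context: For a connected graph $G$ with $n(G)$ vertices and $S\subseteq V(G)$, the Steiner distance $d_G(S)$ is the minimum number of edges of a connected subgraph of $G$ containing $S$. For $v\in V(G)$, $\mathrm{ecc}_3(v,G)=\max\{d_G(S): v\in S\subseteq V(G), |S|=3\}$, and $\mathrm{aecc}_3(G)=\frac{1}{n(G)}\sum_{v\in V(G)}\mathrm{ecc}_3(v,G)$. The broom $B(n,\Delta)$ is the tree of order $n$ obtained from the star $K_{1,\Delta}$ by attaching a path of length $n-\Delta-1$ to an arbitrary pendent vertex of the star (that is, identifying an endpoint of that path with the pendent vertex).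
   Formalization: The equality aecc_3(B(n,Δ)) = n−Δ+1+Δ/n is asserted only for Δ ≥ 3 (for Δ = 2 the broom is a path with aecc_3 = n−1, so it fails; for Δ ≤ 1 ecc_3 is undefined); for all Δ, aecc_3(T) ≤ aecc_3(B(n,Δ)) ≤ n−Δ+1+Δ/n is asserted. *)

(* Defs.v *)
From HB Require Import structures.
From mathcomp Require Import all_boot all_order all_algebra.

Set Implicit Arguments.
Unset Strict Implicit.
Unset Printing Implicit Defensive.

Record sgraph := SGraph {
  vertex :> finType;
  adj : rel vertex;
  adj_sym : symmetric adj;
  adj_irr : irreflexive adj
}.

Definition edge_set (G : sgraph) : {set {set G}} :=
  [set [set p.1; p.2] | p : G * G & adj p.1 p.2].

Definition degree (G : sgraph) (x : G) : nat := #|[set y | adj x y]|.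

Definition max_degree (G : sgraph) : nat := \max_(x : G) degree x.

Definition connected_graph (G : sgraph) : Prop :=
  0 < #|G| /\ forall x y : G, connect (@adj G) x y.

(* [ucycle] counts a single edge, traversed back and forth, as a cycle of
   size 2; genuine cycles have at least three vertices. *)
Definition acyclic (G : sgraph) : Prop :=
  forall c : seq G, ucycle (@adj G) c -> size c <= 2.

Definition is_tree (G : sgraph) : Prop := connected_graph G /\ acyclic G.

(* A subgraph is given by a pair of a vertex set and an edge set. *)
Definition is_subgraph (G : sgraph) (H : {set G} * {set {set G}}) : bool :=
  (H.2 \subset edge_set G) && [forall e in H.2, e \subset H.1].

Definition connected_sub (G : sgraph) (H : {set G} * {set {set G}}) : bool :=
  [forall x in H.1, forall y in H.1,
     connect [rel a b | [set a; b] \in H.2] x y].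

(* The index #|edge_set G| of the minimum is the number of edges of G, which
   is one of the candidate subgraphs whenever G is connected; it is therefore
   neutral in that case. *)
Definition steiner_dist (G : sgraph) (S : {set G}) : nat :=
  \big[minn/#|edge_set G|]_(H : {set G} * {set {set G}}
      | [&& is_subgraph H, connected_sub H & S \subset H.1]) #|H.2|.

(* Equal to 0 when G has fewer than three vertices. *)
Definition ecc3 (G : sgraph) (v : G) : nat :=
  \max_(S : {set G} | (v \in S) && (#|S| == 3)) steiner_dist S.

Definition aecc3 (G : sgraph) : rat :=
  ((\sum_(v : G) (ecc3 v)%:R) / #|G|%:R)%R.

(* Vertex 0 is the centre of the star, 1, ..., D are its pendent vertices, and
   the path D, D + 1, ..., n - 1, of length n - D - 1, is attached at the
   pendent vertex D. This is meant for D < n. *)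
Definition broom_arc (D i j : nat) : bool :=
  [&& i == 0, 0 < j & j <= D] || (D <= i) && (j == i.+1).

Definition broom_adj (n D : nat) : rel 'I_n :=
  [rel i j : 'I_n | broom_arc D i j || broom_arc D j i].

Lemma broom_adj_sym n D : symmetric (@broom_adj n D).
Proof. by move=> i j; exact: orbC. Qed.

Lemma broom_adj_irr n D : irreflexive (@broom_adj n D).
Proof.
move=> i; rewrite /broom_adj [LHS]orbb /broom_arc (ltn_eqF (ltnSn i)) andbF orbF.
by case: eqP => // ->.
Qed.

Definition broom (n D : nat) : sgraph :=
  SGraph (@broom_adj_sym n D) (@broom_adj_irr n D).

(* Main.v *)
(* Upper bound: in a breadth-first spanning tree rooted at a vertex of maximum
   degree Delta, let I be the set of internal vertices. The root keeps all its
   neighbours as children, so #|I| <= n - Delta. For every 3-set S the tree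
   restricted to I :|: S is connected, so the Steiner distance of S is at most
   #|I| + 2, and at most #|I| + 1 if S meets I. Summing over all vertices gives
   the bound, which holds for every connected graph and thus also for the broom.
   Lower bound for the broom: a connected subgraph containing S uses every tree
   edge whose deletion separates S. *)
Require Import Defs.
From mathcomp Require Import all_boot all_order all_algebra zify ring.
Import Order.TTheory GRing.Theory Num.Theory.
Local Open Scope ring_scope.

(** * Steiner distance as a minimum over subgraphs *)

Lemma steiner_dist_le (G : sgraph) (S : {set G}) (H : {set G} * {set {set G}}) :
  is_subgraph H -> connected_sub H -> S \subset H.1 ->
  (steiner_dist S <= #|H.2|)%N.
Proof.
move=> subH conH SH; rewrite /steiner_dist -minEnat -leEnat.
by apply: bigmin_le_cond; rewrite subH conH SH.
Qed.

(** The first hypothesis accounts for the index [#|edge_set G|] of the minimum. *)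
Lemma steiner_dist_ge (G : sgraph) (S : {set G}) (k : nat) :
  (k <= #|edge_set G|)%N ->
  (forall H : {set G} * {set {set G}}, is_subgraph H -> connected_sub H ->
     S \subset H.1 -> (k <= #|H.2|)%N) ->
  (k <= steiner_dist S)%N.
Proof.
move=> kE kH; rewrite /steiner_dist; elim/big_ind: _ => //.
  by move=> a b ka kb; rewrite leq_min ka.
by move=> H /and3P[]; apply: kH.
Qed.

Lemma edge_setP (G : sgraph) (x y : G) :
  reflect (adj x y) ([set x; y] \in edge_set G).
Proof.
apply: (iffP imsetP) => [[[a b] /= ab eqS]|xy]; last first.
  by exists (x, y); rewrite ?inE.
rewrite inE /= in ab.
have ab' : a != b by apply: contraTneq ab => ->; rewrite adj_irr.
have xy : x != y by have := cards2 x y; rewrite eqS cards2 ab'; case: (x != y).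
have /set2P[xE|xE] : x \in [set a; b] by rewrite -eqS set21.
all: have /set2P[yE|yE] : y \in [set a; b] by rewrite -eqS set22.
- by rewrite xE yE eqxx in xy.
- by rewrite xE yE.
- by rewrite xE yE adj_sym.
- by rewrite xE yE eqxx in xy.
Qed.

(** * Spanning trees and the upper bound *)

(* A breadth-first search from [r]. *)
Lemma spanning_parent (G : sgraph) (r : G) : connected_graph G ->
  exists (p : G -> G) (d : G -> nat),
    (forall x, x != r -> adj (p x) x && (d (p x) < d x)%N)
    /\ (forall x, adj r x -> p x = r).
Proof.
move=> [_ con].
pose P x k := [exists t : k.-tuple G, path (@adj G) r t && (last r t == x)].
have exP x : exists k, P x k.
  case/connectP: (con r x) => t pt ->; exists (size t).
  by apply/existsP; exists (in_tuple t); rewrite pt eqxx.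
pose d x := ex_minn (exP x).
have dP x : P x (d x) by rewrite /d; case: ex_minnP.
have dmin x k : P x k -> (d x <= k)%N.
  by rewrite /d; case: ex_minnP => m _; apply.
have parE x : x != r -> exists y, adj y x && (d y < d x)%N.
  (* Removing the last step of a shortest walk gives a neighbour nearer to [r]. *)
  move=> xr; have /existsP[[t /= /eqP st] /andP[pt /eqP lt]] := dP x.
  case/lastP: t st pt lt => [|t y] st pt lt; first by rewrite -lt eqxx in xr.
  rewrite last_rcons in lt; rewrite rcons_path lt in pt.
  case/andP: pt => pt ax; exists (last r t); rewrite ax /= -st size_rcons ltnS.
  by apply: dmin; apply/existsP; exists (in_tuple t); rewrite pt eqxx.
have dr : d r = 0%N.
  apply/eqP; rewrite -leqn0; apply: dmin; apply/existsP.
  by exists [tuple]; rewrite /= eqxx.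
have dpos x : x != r -> (0 < d x)%N.
  by move=> /parE[y /andP[_]]; apply: leq_ltn_trans.
(* Neighbours of [r] are sent to [r] itself; for any other [x != r] the search succeeds, so the
   default is not reached. *)
exists (fun x => if adj r x then r
                 else odflt r [pick y | adj y x && (d y < d x)%N]), d.
split=> [x xr|x ->] //; case: ifP => [rx|_]; first by rewrite rx dr dpos.
case: pickP => [y //|none]; have [y] := parE x xr; by rewrite none.
Qed.

(** Joining each vertex of [W] other than [r] to its parent connects [W]: iterating [p] stays in [W]
    and decreases [d] until it reaches [r]. *)
Lemma steiner_dist_parent_closed (G : sgraph) (r : G) (p : G -> G)
    (d : G -> nat) (W S : {set G}) :
  (forall x, x != r -> adj (p x) x && (d (p x) < d x)%N) ->
  r \in W -> (forall x, x \in W -> x != r -> p x \in W) -> S \subset W ->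
  (steiner_dist S <= #|W|.-1)%N.
Proof.
move=> pP rW pW SW.
pose H : {set G} * {set {set G}} := (W, [set [set p x; x] | x in W :\ r]).
have HE : (#|H.2| <= #|W|.-1)%N.
  by rewrite (cardsD1 r W) rW; apply: leq_imset_card.
apply: leq_trans HE; apply: steiner_dist_le => //.
  apply/andP; split.
    apply/subsetP => e /imsetP[x /setD1P[xr xW] ->]; apply/edge_setP.
    by have /andP[] := pP x xr.
  apply/forall_inP => e /imsetP[x /setD1P[xr xW] ->]; apply/subsetP => y.
  by case/set2P => -> //; apply: pW.
set e := [rel a b | [set a; b] \in H.2].
have esym : connect_sym e by apply: sym_connect_sym => a b /=; rewrite setUC.
have toroot k x : (d x < k)%N -> x \in W -> connect e x r.
  elim: k x => // k IHk x dx xW.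
  have [->|xr] := eqVneq x r; first exact: connect0.
  have /andP[_ dpx] := pP x xr.
  apply: connect_trans (IHk (p x) (leq_trans dpx dx) (pW x xW xr)).
  apply: connect1; rewrite /e /= setUC; apply/imsetP; exists x => //.
  by rewrite !inE xr.
apply/forall_inP => x xW; apply/forall_inP => y yW.
apply: connect_trans (toroot _ x (ltnSn _) xW) _.
by rewrite esym; apply: toroot (ltnSn _) yW.
Qed.

(* [I] collects the internal vertices of a spanning tree in which [r] keeps its
   full degree; the tree has at least [degree r] leaves. *)
Lemma steiner_dist_internal (G : sgraph) (r : G) : connected_graph G ->
  exists I : {set G}, [/\ r \in I, (#|I| + degree r <= #|G|)%N
    & forall S, (steiner_dist S <= #|I :|: S|.-1)%N].
Proof.
move=> conG; have [p [d [pP pr]]] := spanning_parent G r conG.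
pose I := r |: [set p x | x in ~: [set r]].
have Ir : r \in I by rewrite setU11.
have Ip x : x != r -> p x \in I.
  by move=> xr; rewrite inE; apply/orP; right; apply: imset_f; rewrite !inE.
exists I; split=> // [|S]; last first.
  apply: (steiner_dist_parent_closed _ _ _ _ _ _ pP); first by rewrite inE Ir.
    by move=> x _ /Ip pI; rewrite inE pI.
  exact: subsetUr.
pose N := [set y | adj r y].
have rN : r \notin N by rewrite inE adj_irr.
(* Neighbours of [r] have parent [r], so the other members of [I] are parents of vertices outside
   the closed neighbourhood of [r]. *)
have IE : I \subset r |: [set p x | x in ~: (r |: N)].
  apply/subsetP => y /setU1P[->|/imsetP[x]]; first exact: setU11.
  rewrite !inE => xr ->; have [xN|xN] := boolP (adj r x).
    by rewrite pr // eqxx.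
  by apply/orP; right; apply: imset_f; rewrite !inE negb_or xr.
have := subset_leq_card IE; set B := [set p x | x in ~: _].
have : (#|B| <= #|~: (r |: N)|)%N by apply: leq_imset_card.
have := cardsC (r |: N); rewrite !cardsU1 rN /degree -/N.
by do 2 case: (r \notin _) => /=; lia.
Qed.

(** For order n and degree k the right-hand side is n times n - k + 1 + k / n. *)
Lemma sum_ecc3_le (G : sgraph) (r : G) : connected_graph G ->
  (\sum_(v : G) ecc3 v <= (#|G| - 1) * (#|G| - degree r) + #|G| * 2)%N.
Proof.
move=> conG; have [I [Ir Ideg steinerI]] := steiner_dist_internal G r conG.
have I0 : (0 < #|I|)%N by apply/card_gt0P; exists r.
(* The union of [I] and [S] has at most [#|I| + 3] vertices, and at most [#|I| + 2] if [v], which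
   lies in [S], is also in [I]. *)
have eccI (v : G) : (ecc3 v <= #|I| + 1 + (v \notin I))%N.
  apply/bigmax_leqP => S /andP[vS /eqP S3]; apply: leq_trans (steinerI S) _.
  have := cardsUI I S; rewrite S3.
  have [vI|vI] /= := boolP (v \in I); last by lia.
  suff : (0 < #|I :&: S|)%N by lia.
  by apply/card_gt0P; exists v; rewrite inE vI.
apply: (@leq_trans (\sum_(v : G) (#|I| + 1 + (v \notin I)))).
  by apply: leq_sum => v _; apply: eccI.
rewrite big_split /= sum_nat_const.
have -> : (\sum_(v : G) (v \notin I) = #|~: I|)%N.
  rewrite -sum1_card [RHS]big_mkcond; apply: eq_bigr => v _.
  by rewrite inE; case: (v \in I).
(* With a = [#|I|] the sum is (n - 1) a + 2 n, nondecreasing in a. *)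
have := cardsC I; move: Ideg I0; move: #|I| #|~: I| #|G| (degree r) => a b n k.
nia.
Qed.

(** * Crude bounds and graphs of small degree *)

Lemma ecc3_le (G : sgraph) (v : G) : connected_graph G ->
  (ecc3 v <= #|G| - 1)%N.
Proof.
move=> conG; have [I [_ _ steinerI]] := steiner_dist_internal G v conG.
apply/bigmax_leqP => S _; apply: leq_trans (steinerI S) _.
by rewrite -subn1 leq_sub2r // max_card.
Qed.

Lemma ecc3_ge (G : sgraph) (v : G) (S : {set G}) (k : nat) :
  v \in S -> #|S| = 3%N -> (k <= steiner_dist S)%N -> (k <= ecc3 v)%N.
Proof. by move=> vS S3 kS; apply: (bigop.bigmax_sup S); rewrite ?vS ?S3. Qed.

Lemma ecc3_small (G : sgraph) (v : G) : (#|G| <= 2)%N -> ecc3 v = 0%N.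
Proof.
move=> G2; apply/eqP; rewrite -leqn0; apply/bigmax_leqP => S /andP[_ /eqP S3].
by have := leq_trans (max_card (mem S)) G2; rewrite S3.
Qed.

(** The closed neighbourhood [A] of [r] is closed under adjacency, since a neighbour of [r] has no
    neighbour but [r]; by connectedness [A] is everything. *)
Lemma card_max_degree1 (G : sgraph) : connected_graph G ->
  (max_degree G <= 1)%N -> (#|G| <= 2)%N.
Proof.
move=> [/card_gt0P[r _] con] /bigmax_leqP deg1.
pose A := r |: [set y | adj r y].
have Acl x y : adj x y -> x \in A -> y \in A.
  rewrite !inE => xy /orP[/eqP xr|rx]; first by rewrite -xr xy orbT.
  have /card_le1_eqP := deg1 x isT; move/(_ r y).
  by rewrite !inE adj_sym rx xy => /(_ isT isT) ->; rewrite eqxx.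
have cs : connect_sym (@adj G) by apply: sym_connect_sym; apply: adj_sym.
have AT : A = setT.
  apply/setP => x; rewrite in_setT.
  by rewrite -(closed_connect (intro_closed cs Acl) (con r x)) setU11.
rewrite -cardsT -AT cardsU1; have := deg1 r isT; rewrite /degree.
by case: (_ \notin _) => /=; lia.
Qed.

Lemma degree_lt (G : sgraph) (x : G) : (degree x < #|G|)%N.
Proof.
rewrite -cardsT; apply: proper_card; apply/properP; split=> //.
by exists x; rewrite ?inE // adj_irr.
Qed.

Lemma max_degree_attained (G : sgraph) :
  (0 < #|G|)%N -> exists r : G, degree r = max_degree G.
Proof. by case/(bigop.eq_bigmax (@degree G)) => r rD; exists r. Qed.


(** * The broom as a tree rooted at its centre *)

Section Broom.
Variables n D : nat.
Hypothesis Dn : (D < n)%N.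
Local Open Scope nat_scope.
Notation B := (broom n D).

Lemma broom_order : #|B| = n.
Proof. exact: card_ord. Qed.

(* Every nonzero vertex [j] of the broom has a unique smaller neighbour. *)
Definition broom_parent_nat (j : nat) : nat := if j <= D then 0 else j.-1.

Lemma broom_parent_nat_lt (j : 'I_n) : broom_parent_nat j < n.
Proof. by have := ltn_ord j; rewrite /broom_parent_nat; case: ifP; lia. Qed.

Definition broom_parent (j : 'I_n) : 'I_n := Ordinal (broom_parent_nat_lt j).

Lemma broom_arcE (i j : 'I_n) :
  broom_arc D i j = (0 < j) && (i == broom_parent j).
Proof.
rewrite -val_eqE /= /broom_arc /broom_parent_nat.
by case: i j => [i /= iD] [j /= jD]; case: (leqP j D) => jD'; lia.
Qed.

Lemma broom_adjE (i j : 'I_n) :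
  @adj B i j = (0 < j) && (i == broom_parent j)
               || (0 < i) && (j == broom_parent i).
Proof. by rewrite -!broom_arcE. Qed.

Lemma broom_parent_adj (j : 'I_n) : 0 < j -> @adj B (broom_parent j) j.
Proof. by move=> j0; rewrite broom_adjE j0 eqxx. Qed.

Definition broom0 : 'I_n := Ordinal (leq_ltn_trans (leq0n D) Dn).

Lemma broom_connected : connected_graph B.
Proof.
split; first by apply/card_gt0P; exists broom0.
have cs : connect_sym (@adj B) by apply: sym_connect_sym; apply: adj_sym.
suff to0 k (j : 'I_n) : j <= k -> connect (@adj B) broom0 j.
  move=> x y; apply: connect_trans (to0 _ y (leqnn _)).
  by rewrite cs; apply: to0.
elim: k j => [|k IHk] j jk.
  by have -> : j = broom0 by apply: val_inj; apply/eqP; rewrite -leqn0.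
have [j0|j0] := posnP j; first by apply: IHk; rewrite j0.
apply: connect_trans (connect1 (broom_parent_adj j j0)); apply: IHk.
by rewrite /= /broom_parent_nat; case: ifP; lia.
Qed.

Lemma broom0_degree : D <= @degree B broom0.
Proof.
(* [f i] is the vertex i + 1, because [ltn_ord i] unfolds to i + 1 <= D. *)
pose f (i : 'I_D) : B := Ordinal (leq_ltn_trans (ltn_ord i) Dn).
have fi : injective f by move=> i j /(congr1 val) /= [] /val_inj.
rewrite -{1}[D]card_ord -(card_imset _ fi); apply: subset_leq_card.
apply/subsetP => _ /imsetP[i _ ->]; rewrite inE; apply/orP; left => /=.
by have := ltn_ord i; rewrite /broom_arc /=; lia.
Qed.

(** * Separating edges and Steiner distances in the broom *)

(* The component of [j] after deletion of the edge from [j] to its parent. *)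
Definition broom_branch (j : 'I_n) : {set 'I_n} :=
  [set i : 'I_n | (i == j) || (D <= j <= i)].

(** Without this edge the branch of [j] would be closed under adjacency in [H], so a connected [H]
    could not meet both the branch and its complement. *)
Lemma broom_cut (H : {set 'I_n} * {set {set 'I_n}}) (j x y : 'I_n) :
  @is_subgraph B H -> @connected_sub B H -> x \in H.1 -> y \in H.1 -> 0 < j ->
  x \in broom_branch j -> y \notin broom_branch j ->
  [set broom_parent j; j] \in H.2.
Proof.
move=> /andP[/subsetP HE _] /forall_inP con xH yH j0 xj; apply: contraNT => jH.
have /forall_inP/(_ y yH) cxy := con x xH.
set e := [rel a b | _] in cxy.
have cs : connect_sym e by apply: sym_connect_sym => a b /=; rewrite setUC.
have cl a b : e a b -> a \in broom_branch j -> b \in broom_branch j.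
  move=> eab aj; have /edge_setP := HE _ eab; rewrite broom_adjE.
  case/orP => /andP[b0 /eqP pE].
    move: aj; rewrite pE !inE -!val_eqE /= /broom_parent_nat.
    by case: (leqP b D) => bD; lia.
  (* A step from [a] to its parent leaves the branch only at [a = j], along the edge assumed
     absent. *)
  have aNj : a != j by apply: contra jH => /eqP <-; rewrite -pE setUC.
  move: aj aNj; rewrite pE !inE -!val_eqE /= /broom_parent_nat.
  by case: (leqP a D) => aD; lia.
by rewrite -(closed_connect (intro_closed cs cl) cxy).
Qed.

(** A parent is smaller than its child, so the child is the larger end of the edge. *)
Lemma broom_parent_edge_inj :
  {in [pred j : 'I_n | 0 < j] &,
    injective (fun j : B => [set broom_parent j; j])}.
Proof.
have lt_par (j : 'I_n) : 0 < j -> broom_parent j < j.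
  by rewrite /= /broom_parent_nat; case: ifP; lia.
move=> i j /lt_par ip /lt_par jp eqS; apply: val_inj; apply/eqP.
have /set2P[iE|<- //] : i \in [set broom_parent j; j] by rewrite -eqS set22.
have /set2P[jE|-> //] : j \in [set broom_parent i; i] by rewrite eqS set22.
by move: ip jp; rewrite -iE -jE; lia.
Qed.

(** Each [j] in [J] stands for its parent edge, which separates two vertices of [S]; these edges are
    distinct and lie in every connected subgraph containing [S]. *)
Lemma broom_steiner_dist_ge (S J : {set 'I_n}) :
  (forall j, j \in J -> 0 < j /\
     exists x y, [/\ x \in S, y \in S, x \in broom_branch j
                   & y \notin broom_branch j]) ->
  #|J| <= @steiner_dist B S.
Proof.
move=> JP.
have <- : #|[set [set broom_parent j; j] | j in J]| = #|J|.
  apply: card_in_imset => i j /JP[i0 _] /JP[j0 _].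
  exact: broom_parent_edge_inj.
apply: steiner_dist_ge => [|H subH conH /subsetP SH]; apply: subset_leq_card.
  apply/subsetP => _ /imsetP[j /JP[j0 _] ->]; apply/edge_setP.
  exact: broom_parent_adj.
apply/subsetP => _ /imsetP[j /JP[j0 [x [y [xS yS xj yj]]]] ->].
by apply: (broom_cut H j x y) => //; apply: SH.
Qed.

(** * Eccentricities in the broom *)

Lemma broom_last_subproof : n.-1 < n.
Proof. by lia. Qed.

Definition broom_last : 'I_n := Ordinal broom_last_subproof.

(** The parent edges of these vertices form the path from the centre to [broom_last]. *)
Lemma broom_path_card : n - D <= #|[set j : 'I_n | D <= j]|.
Proof.
have fP (i : 'I_(n - D)) : D + i < n by have := ltn_ord i; lia.
pose f (i : 'I_(n - D)) : 'I_n := Ordinal (fP i).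
have fi : injective f by move=> i j /(congr1 val) /= /addnI /val_inj.
rewrite -{1}[n - D]card_ord -(card_imset _ fi); apply: subset_leq_card.
by apply/subsetP => _ /imsetP[i _ ->]; rewrite inE /= leq_addr.
Qed.

(** The path from the leaf [a] through the centre to [broom_last] has n - D + 1 edges; [u] only
    completes the triple. *)
Lemma broom_ecc3_ge_path (u a v : 'I_n) : 0 < a < D -> u != a ->
  u != broom_last -> v \in [set u; a; broom_last] -> n - D + 1 <= @ecc3 B v.
Proof.
move=> aD ua ul vS.
have al : a != broom_last by rewrite -val_eqE /=; lia.
apply: (ecc3_ge B v [set u; a; broom_last]) => //.
  by rewrite -setUA cardsU1 cards2 !inE negb_or ua ul al.
have aJ : a \notin [set j : 'I_n | D <= j] by rewrite inE; lia.
apply: (@leq_trans #|a |: [set j : 'I_n | D <= j]|).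
  by rewrite cardsU1 aJ; have := broom_path_card; lia.
apply: broom_steiner_dist_ge => j /setU1P[->|].
  split; first by lia.
  by exists a, broom_last; split; rewrite !inE -!val_eqE /= ?eqxx ?orbT //; lia.
rewrite inE => Dj; have jn := ltn_ord j; split; first by lia.
by exists broom_last, a; split; rewrite !inE -!val_eqE /= ?eqxx ?orbT //; lia.
Qed.

(** A second leaf [u] at the centre adds its own edge to that path. *)
Lemma broom_ecc3_ge_leaves (u a v : 'I_n) : 0 < a < D -> 0 < u < D -> u != a ->
  v \in [set u; a; broom_last] -> n - D + 2 <= @ecc3 B v.
Proof.
move=> aD uD ua vS.
have al : a != broom_last by rewrite -val_eqE /=; lia.
have ul : u != broom_last by rewrite -val_eqE /=; lia.
apply: (ecc3_ge B v [set u; a; broom_last]) => //.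
  by rewrite -setUA cardsU1 cards2 !inE negb_or ua ul al.
have aJ : a \notin [set j : 'I_n | D <= j] by rewrite inE; lia.
have uJ : u \notin a |: [set j : 'I_n | D <= j].
  by rewrite !inE negb_or ua; lia.
apply: (@leq_trans #|u |: (a |: [set j : 'I_n | D <= j])|).
  by rewrite !cardsU1 aJ uJ; have := broom_path_card; lia.
apply: broom_steiner_dist_ge => j /setU1P[->|/setU1P[->|]].
- split; first by lia.
  by exists u, broom_last; split; rewrite !inE -!val_eqE /= ?eqxx ?orbT //; lia.
- split; first by lia.
  by exists a, broom_last; split; rewrite !inE -!val_eqE /= ?eqxx ?orbT //; lia.
- rewrite inE => Dj; have jn := ltn_ord j; split; first by lia.
  by exists broom_last, a; split; rewrite !inE -!val_eqE /= ?eqxx ?orbT //; lia.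
Qed.

Lemma broom_ecc3_ge (v : 'I_n) : 2 <= D -> n - D + 1 <= @ecc3 B v.
Proof.
move=> D2; have n1 : 1 < n by lia.
pose b1 : 'I_n := Ordinal n1.
have [/orP v1|/norP[v1 vl]] := boolP ((v == b1) || (v == broom_last)).
  (* Here [v] is already an end of the path, and the centre serves as third vertex. *)
  apply: (broom_ecc3_ge_path broom0 b1) => //=; rewrite -?val_eqE /=; try lia.
  by case: v1 => /eqP ->; rewrite !inE eqxx ?orbT.
by apply: (broom_ecc3_ge_path v b1); rewrite ?inE ?eqxx.
Qed.

Lemma broom_ecc3_leaf_ge (v : 'I_n) : 3 <= D ->
  (0 < v < D) || (v == broom_last) -> n - D + 2 <= @ecc3 B v.
Proof.
move=> D3; have [n1 n2] : 1 < n /\ 2 < n by lia.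
pose b1 : 'I_n := Ordinal n1; pose b2 : 'I_n := Ordinal n2.
case/orP => [vD|/eqP ->]; last first.
  by apply: (broom_ecc3_ge_leaves b1 b2); rewrite ?inE ?eqxx ?orbT //=; lia.
have [->|v1] := eqVneq v b1.
  by apply: (broom_ecc3_ge_leaves b1 b2); rewrite ?inE ?eqxx ?orbT //=; lia.
by apply: (broom_ecc3_ge_leaves v b1); rewrite ?inE ?eqxx ?orbT //=; lia.
Qed.

Lemma broom_leaf_card :
  D <= #|[set v : 'I_n | (0 < v < D) || (v == broom_last)]|.
Proof.
(* The index 0, the centre and not a leaf, is redirected to the last vertex. *)
have fP (i : 'I_D) : (if i == 0 :> nat then n.-1 else i) < n.
  by have := ltn_ord i; case: ifP; lia.
pose f (i : 'I_D) : 'I_n := Ordinal (fP i).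
have fi : injective f.
  move=> i j /(congr1 val) /= ij; apply: val_inj => /=; move: ij.
  by have := ltn_ord i; have := ltn_ord j; do 2 case: ifP; lia.
rewrite -{1}[D]card_ord -(card_imset _ fi); apply: subset_leq_card.
apply/subsetP => _ /imsetP[i _ ->]; rewrite inE -val_eqE /=.
by have := ltn_ord i; case: ifP; lia.
Qed.

(** * The eccentricity sum of the broom *)

Lemma sum_broom_ecc3_le :
  \sum_(v : B) ecc3 v <= (n - 1) * (n - D) + n * 2.
Proof.
apply: leq_trans (sum_ecc3_le B broom0 broom_connected) _.
rewrite broom_order leq_add2r leq_mul2l leq_sub2l ?orbT //.
exact: broom0_degree.
Qed.

(** Every vertex contributes at least n - D + 1, and each of the D leaves one more. *)
Lemma sum_broom_ecc3_ge : 3 <= D ->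
  (n - 1) * (n - D) + n * 2 <= \sum_(v : B) ecc3 v.
Proof.
move=> D3; pose leaf (v : 'I_n) := (0 < v < D) || (v == broom_last).
apply: (@leq_trans (\sum_(v : 'I_n) (n - D + 1 + leaf v))); last first.
  apply: leq_sum => v _; have [lv|_] := boolP (leaf v).
    by rewrite -addnA; apply: broom_ecc3_leaf_ge.
  by rewrite addn0; apply: broom_ecc3_ge => //; apply: ltnW.
rewrite big_split /= sum_nat_const card_ord.
suff : D <= \sum_(v : 'I_n) leaf v.
  rewrite mulnBl mulnDr; move: (\sum_(v : 'I_n) leaf v).
  by have := leq_pmull (n - D) (leq_ltn_trans (leq0n D) Dn); lia.
apply: leq_trans broom_leaf_card _; rewrite -sum1_card big_mkcond /=.
by apply: leq_sum => v _; rewrite inE /leaf; case: ifP.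
Qed.

End Broom.

(** * Comparison with the broom *)

(** For maximum degree at most 1 there are no triples; for degree 2 the broom is a path, where every
    vertex attains the trivial bound n - 1; from degree 3 on the broom attains the general bound. *)
Lemma sum_ecc3_le_broom (G : sgraph) : connected_graph G ->
  (\sum_(v : G) ecc3 v
     <= \sum_(v : broom #|G| (max_degree G)) ecc3 v)%N.
Proof.
move=> conG; have [G0 _] := conG.
have [r rD] := max_degree_attained G G0.
have Dn : (max_degree G < #|G|)%N by rewrite -rD degree_lt.
have [D1|D2] := leqP (max_degree G) 1.
  by rewrite big1 // => v _; apply: ecc3_small; apply: card_max_degree1.
have [D3|D3] := leqP 3 (max_degree G).
  apply: leq_trans (sum_broom_ecc3_ge _ _ Dn D3).
  by have := sum_ecc3_le G r conG; rewrite rD.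
have {D2 D3} D2 : max_degree G = 2 by lia.
apply: (@leq_trans (#|G| * (#|G| - 1))%N).
  rewrite -sum_nat_const; apply: leq_sum => v _; exact: ecc3_le.
rewrite -{1}[#|G|]card_ord -sum_nat_const; apply: leq_sum => v _.
have := broom_ecc3_ge _ _ Dn v; rewrite D2 => /(_ isT); apply: leq_trans.
by lia.
Qed.

Lemma aecc3E (G : sgraph) : aecc3 G = (\sum_(v : G) ecc3 v)%N%:R / #|G|%:R.
Proof. by rewrite /aecc3 natr_sum. Qed.

Lemma broom_valueE (n D : nat) : (D < n)%N ->
  n%:R - D%:R + 1 + D%:R / n%:R
    = ((n - 1) * (n - D) + n * 2)%N%:R / n%:R :> rat.
Proof.
move=> Dn; have n0 : n%:R != 0 :> rat by rewrite pnatr_eq0; lia.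
rewrite natrD !natrM !natrB //; [by field | by lia | by lia].
Qed.

(** Equality requires [3 <= Delta]: for [Delta = 2] the average is at most n - 1, below the closed
    value n - 1 + 2 / n, and for [Delta <= 1] it is 0. *)
Theorem theorem5p2 (T : sgraph) (n Delta : nat)
    (treeT : is_tree T) (orderT : #|T| = n) (degT : max_degree T = Delta) :
  aecc3 T <= aecc3 (broom n Delta)
          <= n%:R - Delta%:R + 1 + Delta%:R / n%:R
  /\ ((3 <= Delta)%N ->
      aecc3 (broom n Delta) = n%:R - Delta%:R + 1 + Delta%:R / n%:R).
Proof.
have [conT _] := treeT; have [T0 _] := conT.
have Dn : (Delta < n)%N.
  have [r] := max_degree_attained T T0.
  by rewrite degT -orderT => <-; exact: degree_lt.
have n0 : 0 < n%:R :> rat by rewrite ltr0n; lia.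
rewrite broom_valueE // !aecc3E broom_order orderT.
rewrite !ler_pM2r ?invr_gt0 // !ler_nat sum_broom_ecc3_le // andbT.
split; first by have := sum_ecc3_le_broom T conT; rewrite degT orderT.
move=> D3; congr (_%:R / _); apply/eqP.
by rewrite eqn_leq sum_broom_ecc3_le // sum_broom_ecc3_ge.
Qed.
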